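(* Let $\theta\in[0,1]$, let $m\in\{0,\dots,N_x-1\}$, and let $v_k\in\mathbb R^{N_v}$ satisfy $Av_k=\lambda_kv_k$, $\lambda_k\ge 0$, $\|v_k\|_2=1$. Put $\mu_k:=\lambda_k\frac{\Delta t}{(\Delta x)^2}$ and $\psi_{m,k}:=2\mu_ky_m$. Assume that $U^n=x_mv_k^T$. Then one step of the DtP $\theta$-scheme (defined in the context) gives $$U^{n+1}=g_\theta(\psi_{m,k})\,U^n,\qquad\text{where}\qquad g_\theta(\psi)=\frac{1+(1-\theta)\psi}{(1+\psi)^2(1-\theta\psi)}.$$ In particular, if $\theta=0$, then $g_0(\psi)=\frac{1}{1+\psi}$ for $\psi\ge 0$. If $\theta>0$ and $\theta\ne 1/2$, then $g_\theta(\psi)$ becomes unbounded as $\psi$ approaches $1/\theta$ from below.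
   Context: Let $A\in\mathbb R^{N_v\times N_v}$ be symmetric positive semidefinite, $\Delta t,\Delta x>0$, $\tau:=\frac{\Delta t}{(\Delta x)^2}$. Let $E_+,E_-\in\mathbb R^{N_x\times N_x}$ be the periodic shift matrices $(E_+w)_j=w_{j+1}$, $(E_-w)_j=w_{j-1}$ (indices modulo $N_x$), and $M_2=2I-E_+-E_-$. For $m=0,\dots,N_x-1$ the Fourier mode $x_m\in\mathbb C^{N_x}$ is $(x_m)_j:=\frac{1}{\sqrt{N_x}}e^{ij\alpha_m}$, $\alpha_m:=\frac{2\pi m}{N_x}$, $j=1,\dots,N_x$, and $y_m:=1-\cos\alpha_m\in[0,2]$; thus $M_2x_m=2y_mx_m$. DtP (discretize-then-project) $\theta$-scheme of rank $r$ for $\dot U=-\frac{1}{(\Delta x)^2}M_2UA$, with $\theta\in[0,1]$: from $U^n=X^nS^n(V^n)^T$, with $X^n$ ($N_x\times r$) and $V^n$ ($N_v\times r$) having orthonormal columns and $S^n$ of size $r\times r$, put $K^n=X^nS^n$ and $\widetilde A=(V^n)^TAV^n$. One step is: K-step: $K^{n+1}=K^n-\tau M_2K^{n+1}\widetilde A$; take a QR factorization $K^{n+1}=X^{n+1}S^{(1)}$ with $X^{n+1}$ having orthonormal columns. S-step: $S^{(2)}=S^{(1)}+\tau M_{2,X}\bigl((1-\theta)S^{(1)}+\theta S^{(2)}\bigr)\widetilde A$, where $M_{2,X}:=(X^{n+1})^*M_2X^{n+1}$. L-step: with $L^n:=S^{(2)}(V^n)^T$, $L^{n+1}=L^n-\tau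 M_{2,X}L^{n+1}A$; take a QR factorization $(L^{n+1})^T=V^{n+1}(S^{n+1})^T$. Then $U^{n+1}=X^{n+1}L^{n+1}=X^{n+1}S^{n+1}(V^{n+1})^T$. Here $X^*$ denotes the conjugate transpose (equal to $X^T$ for real factors). For the single-mode state $U^n=x_mv_k^T$ the scheme is run with $r=1$, $X^n=x_m$, $S^n=1$, $V^n=v_k$, and complex entries are allowed in $X$, $S$ and $L$. *)

(* Defs.v *)
From HB Require Import structures.
From mathcomp Require Import all_boot all_order all_algebra.
From mathcomp Require Import all_classical all_reals all_analysis.
From mathcomp Require Import complex.

Set Implicit Arguments.
Unset Strict Implicit.
Unset Printing Implicit Defensive.

Import Order.TTheory GRing.Theory Num.Theory.
Import numFieldNormedType.Exports.

Local Open Scope ring_scope.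
Local Open Scope complex_scope.
Local Open Scope sesquilinear_scope.

Notation toCmx := (map_mx (real_complex _)).

Definition psd (R : realType) (n : nat) (A : 'M[R]_n) : Prop :=
  A^T = A /\ forall w : 'cV[R]_n, 0 <= (w^T *m A *m w) 0 0.

(* The norm `|v| of the library on matrices is the sup norm. *)
Definition norm2 (R : realType) (n : nat) (v : 'cV[R]_n) : R :=
  Num.sqrt (\sum_i v i 0 ^+ 2).

(* Row j has its 1 in column j + 1, resp. j - 1, modulo n. *)
Definition shiftp (R : realType) (n : nat) : 'M[R]_n :=
  \matrix_(j, k) (k == ordS j)%:R.
Definition shiftm (R : realType) (n : nat) : 'M[R]_n :=
  \matrix_(j, k) (k == ord_pred j)%:R.

(* For n <= 2 the two shifts coincide and their entries add up; M2 = 0 for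
   n = 1. *)
Definition M2 (R : realType) (n : nat) : 'M[R]_n :=
  2%:M - shiftp R n - shiftm R n.

Definition alpha (R : realType) (n : nat) (m : 'I_n) : R :=
  2 * pi * m%:R / n%:R.

Definition ymode (R : realType) (n : nat) (m : 'I_n) : R :=
  1 - cos (alpha R m).

(* j : 'I_n stands for the grid index j + 1 in {1, ..., n}. *)
Definition fourier (R : realType) (n : nat) (m : 'I_n) : 'cV[R[i]]_n :=
  \col_(j < n) (((Num.sqrt n%:R)^-1)%:C *
    (cos (j.+1%:R * alpha R m) +i* sin (j.+1%:R * alpha R m))).

Definition orthonormal_cols (R : realType) (n r : nat)
    (X : 'M[R[i]]_(n, r)) : Prop :=
  X^t* *m X = 1%:M.

(* is_trig_mx is lower triangularity, hence the transpose. *)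
Definition is_QR (R : realType) (n r : nat)
    (K X : 'M[R[i]]_(n, r)) (S : 'M[R[i]]_r) : Prop :=
  [/\ orthonormal_cols X, is_trig_mx S^T & K = X *m S].

(* The factors X, S, V of U = X S V^T; complex entries are allowed in X and S
   only. *)
Record factors (R : realType) (nx nv r : nat) := Factors {
  fX : 'M[R[i]]_(nx, r);
  fS : 'M[R[i]]_r;
  fV : 'M[R]_(nv, r)
}.

Definition assemble (R : realType) (nx nv r : nat) (s : factors R nx nv r) :
    'M[R[i]]_(nx, nv) :=
  fX s *m fS s *m (toCmx (fV s))^T.

(* One DtP step of parameter theta from s to s'. It is a relation since the
   substeps are implicit linear systems and QR factors are not unique. *)
Definition dtp_step (R : realType) (nx nv r : nat) (A : 'M[R]_nv)
    (theta dt dx : R) (s s' : factors R nx nv r) : Prop :=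
  let tau := (dt / dx ^+ 2)%:C in
  let th := theta%:C in
  let M := toCmx (M2 R nx) in
  let At := toCmx ((fV s)^T *m A *m fV s) in
  let K := fX s *m fS s in
  let MX := (fX s')^t* *m M *m fX s' in
  [/\ orthonormal_cols (fX s), orthonormal_cols (toCmx (fV s)) &
   exists (K' : 'M[R[i]]_(nx, r)) (S1 S2 : 'M[R[i]]_r)
          (L' : 'M[R[i]]_(r, nv)),
   let L := S2 *m (toCmx (fV s))^T in
   [/\ K' = K - tau *: (M *m K' *m At),
       is_QR K' (fX s') S1,
       S2 = S1 + tau *: (MX *m ((1 - th) *: S1 + th *: S2) *m At),
       L' = L - tau *: (MX *m L' *m toCmx A) &
       is_QR L'^T (toCmx (fV s')) (fS s')^T]].

Definition gDtP (R : realType) (theta psi : R) : R :=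
  (1 + (1 - theta) * psi) / ((1 + psi) ^+ 2 * (1 - theta * psi)).

(* Main.v *)
(* Every factor of a rank-one step is a multiple of x_m or of v_k: M_2 and A
   are positive semidefinite, so I + c M_2 and I + c A are injective for c >= 0
   and the implicit K- and L-steps have exactly the solutions that multiply the
   eigenvectors x_m and v_k by 1 / (1 + psi). The QR freedom only rescales X by
   a unit complex number, which leaves M_{2,X} = 2 y_m unchanged and cancels in
   the product X L. The S-step is then the scalar equation
   (1 - theta psi) S2 = (1 + (1 - theta) psi) S1; at theta psi = 1 it would
   force S1 = 0, so it has no solution there. *)
Require Import Defs.
From HB Require Import structures.
From mathcomp Require Import all_boot all_order all_algebra.
From mathcomp Require Import all_classical all_reals all_analysis.
From mathcomp Require Import complex.
From mathcomp Require Import ring lra.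

Set Implicit Arguments.
Unset Strict Implicit.
Unset Printing Implicit Defensive.

Import Order.TTheory GRing.Theory Num.Theory.
Import numFieldNormedType.Exports.

Local Open Scope classical_set_scope.
Local Open Scope ring_scope.
Local Open Scope complex_scope.

(** * The periodic second-difference matrix *)

(** The morphism [f] lets one computation serve both the real quadratic form and the complex Fourier
    modes. *)
Lemma mulmx_M2E (R : realType) (S : pzRingType) (f : {rmorphism R -> S})
    (n p : nat) (w : 'M[S]_(n, p)) (j : 'I_n) (k : 'I_p) :
  (map_mx f (M2 R n) *m w) j k
    = 2 * w j k - w (ordS j) k - w (ord_pred j) k.
Proof.
have row_pick (h : 'I_n) : \sum_i (i == h)%:R * w i k = w h k.
  rewrite (bigD1 h) //= eqxx mul1r big1 ?addr0 // => i /negbTE ->.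
  by rewrite mul0r.
rewrite !mxE -(row_pick (ordS j)) -(row_pick (ord_pred j)) -(row_pick j).
rewrite mulr_sumr -!sumrB; apply: eq_bigr => i _.
rewrite !mxE !rmorphB !rmorph_nat !mulrBl mulrA eq_sym.
congr (_ * _ - _ - _).
by case: (i == j); rewrite ?mulr1n ?mulr0n ?rmorph0 ?rmorph_nat ?mulr1 ?mulr0.
Qed.

(* Summation by parts: [w^T M2 w] is the sum of the squared increments of w. *)
Lemma psd_M2 (R : realType) (n : nat) : psd (M2 R n).
Proof.
split.
  rewrite /M2 !linearB /= tr_scalar_mx -addrA [- _ - _]addrC addrA.
  (* The two shifts are inverse permutations, so transposition exchanges them. *)
  have shiftC (i j : 'I_n) : (i == ordS j) = (j == ord_pred i).
    by rewrite -(can_eq (@ord_predK n)) eq_sym ordSK eq_sym.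
  by congr (_ - _ - _); apply/matrixP => i j; rewrite !mxE shiftC.
move=> w; rewrite -mulmxA mxE.
under eq_bigr => j _.
  rewrite -[M2 R n](map_mx_id (f := idfun)) // (mulmx_M2E idfun) mxE.
  over.
have -> : \sum_j w j 0 * (2 * w j 0 - w (ordS j) 0 - w (ord_pred j) 0)
    = \sum_j (w (ordS j) 0 - w j 0) ^+ 2.
  have reindexS (F : 'I_n -> R) : \sum_j F (ordS j) = \sum_j F j.
    by rewrite [RHS](reindex (@ordS n)) //; exists (@ord_pred n) => i _;
      rewrite ?ordSK ?ord_predK.
  have e1 := reindexS (fun j => w j 0 * w (ord_pred j) 0).
  have e2 := reindexS (fun j => w j 0 ^+ 2).
  apply/eqP; rewrite -subr_eq0 -sumrB; apply/eqP.
  (* The summands differ by two increments along the cyclic shift, and each increment sums to zero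
     over a period. *)
  rewrite (eq_bigr (fun j =>
      (w (ordS j) 0 * w (ord_pred (ordS j)) 0 - w j 0 * w (ord_pred j) 0)
      - (w (ordS j) 0 ^+ 2 - w j 0 ^+ 2))); last first.
    by move=> j _; rewrite ordSK; ring.
  by rewrite !sumrB e1 e2 !subrr.
by apply: sumr_ge0 => j _; rewrite sqr_ge0.
Qed.

(** * Resolvents of positive semidefinite matrices *)

(** Testing with $w^T$ gives $\|w\|^2 + c\,w^TPw = 0$, a sum of two nonnegative terms. *)
Lemma psd_resolvent_inj (R : realType) (n : nat) (P : 'M[R]_n) (c : R)
    (w : 'cV[R]_n) :
  psd P -> 0 <= c -> w + c *: (P *m w) = 0 -> w = 0.
Proof.
move=> [_ P_ge0] c_ge0 /(congr1 (mulmx w^T)).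
rewrite mulmx0 mulmxDr -scalemxAr mulmxA.
move=> /(congr1 (fun B : 'M[R]_1 => B 0 0)).
rewrite mxE [X in _ + X]mxE [RHS]mxE => e.
have sq_ge0 (i : 'I_n) : 0 <= w i 0 ^+ 2 by rewrite sqr_ge0.
have ww : (w^T *m w) 0 0 = \sum_i w i 0 ^+ 2.
  by rewrite mxE; apply: eq_bigr => i _; rewrite mxE expr2.
have /eqP : \sum_i w i 0 ^+ 2 = 0.
  apply: le_anti; rewrite sumr_ge0 // andbT -ww.
  by rewrite -e lerDl mulr_ge0.
rewrite psumr_eq0 // => /allP w0; apply/colP => i; rewrite mxE.
by apply/eqP; rewrite -sqrf_eq0; exact: (w0 i (mem_index_enum i)).
Qed.

(* The coefficients are real, so the real and imaginary parts of a complex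
   solution solve the real equation separately. *)
Lemma psd_resolvent_inj_complex (R : realType) (n : nat) (P : 'M[R]_n) (c : R)
    (w : 'cV[R[i]]_n) :
  psd P -> 0 <= c -> w + c%:C *: (toCmx P *m w) = 0 -> w = 0.
Proof.
move=> psdP c_ge0 w0.
have part0 (f : R[i] -> R) : {morph f : x y / x + y} ->
    (forall a z, f (a%:C * z) = a * f z) -> map_mx f w = 0.
  move=> fD fZ; apply: (psd_resolvent_inj psdP c_ge0).
  have f0 : f 0 = 0.
    by rewrite -[X in f X](mul0r 0) -(rmorph0 (real_complex R)) fZ mul0r.
  apply/colP => i; have /colP/(_ i)/(congr1 f) := w0.
  rewrite !mxE f0 fD fZ (big_morph f fD f0) => e0; rewrite -[RHS]e0.
  congr (_ + c * _).
  by apply: eq_bigr => j _; rewrite !mxE fZ.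
have /colP re0 := part0 (@complex.Re R) ltac:(by case=> ? ? [? ?])
  ltac:(by move=> a [x y] /=; rewrite mul0r subr0).
have /colP im0 := part0 (@complex.Im R) ltac:(by case=> ? ? [? ?])
  ltac:(by move=> a [x y] /=; rewrite mul0r addr0).
apply/colP => i; have := re0 i; have := im0 i; rewrite !mxE.
by case: (w i 0) => x y /= -> ->.
Qed.

Lemma psd_resolvent_unique (R : realType) (n : nat) (P : 'M[R]_n) (c : R)
    (b w1 w2 : 'cV[R[i]]_n) :
  psd P -> 0 <= c -> w1 = b - c%:C *: (toCmx P *m w1) ->
  w2 = b - c%:C *: (toCmx P *m w2) -> w1 = w2.
Proof.
move=> psdP c_ge0 e1 e2; apply/eqP; rewrite -subr_eq0; apply/eqP.
apply: (psd_resolvent_inj_complex psdP c_ge0).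
by rewrite mulmxBr scalerBr {1}e1 {1}e2 opprB [X in X + _]addrC !subrKA subrr.
Qed.

(** On [x] the matrix $I + cP$ acts as the positive scalar $1 + ce$, and injectivity excludes other
    solutions. It serves the K-step with [M2] and the L-step with [A]: left to right to evaluate a
    given step, right to left to construct one. *)
Lemma resolvent_eigenvector (R : realType) (n : nat) (P : 'M[R]_n) (c e : R)
    (x w : 'cV[R[i]]_n) (a : R[i]) :
  psd P -> 0 <= c -> 0 <= e -> toCmx P *m x = e%:C *: x ->
  (w = a *: x - c%:C *: (toCmx P *m w)) <->
  (w = (a / (1 + c * e)%:C) *: x).
Proof.
move=> psdP c_ge0 e_ge0 Px.
have d_neq0 : (1 + c * e)%:C != 0.
  by rewrite fmorph_eq0 gt_eqF // ltr_pwDl // mulr_ge0.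
have sol : (a / (1 + c * e)%:C) *: x
    = a *: x - c%:C *: (toCmx P *m ((a / (1 + c * e)%:C) *: x)).
  rewrite -scalemxAr Px !scalerA -scalerBl; congr (_ *: _).
  move: d_neq0; rewrite rmorphD rmorphM rmorph1 => d_neq0.
  by field.
split=> [ew | -> //]; exact: psd_resolvent_unique ew sol.
Qed.

(** * Fourier modes as unit eigenvectors *)

Definition cis (R : realType) (t : R) : R[i] := cos t +i* sin t.

(** With [t] the mode angle, this merges the two neighbours of a grid point into a multiple of the
    value at that point. *)
Lemma cisDJ (R : realType) (s t : R) :
  cis (s + t) + cis (s - t) = 2 * (cos t)%:C * cis s.
Proof.
rewrite /cis cosD cosB sinD sinB; apply/eqP; rewrite eq_complex /=.
by apply/andP; split; apply/eqP; ring.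
Qed.

Lemma cis_sqr_norm (R : realType) (t : R) : conjc (cis t) * cis t = 1.
Proof.
apply/eqP; rewrite eq_complex /=; apply/andP; split; apply/eqP; last by ring.
by rewrite -[RHS](cos2Dsin2 t); ring.
Qed.

(** Since $n\alpha_m = 2\pi m$, a shift of the index by $n$ adds whole turns. Hence the wrap-around
    of the periodic shifts does not affect a mode. *)
Lemma cis_alpha_mod (R : realType) (n k l : nat) (m : 'I_n) :
  k = l %[mod n] -> cis (k%:R * alpha R m) = cis (l%:R * alpha R m).
Proof.
have n_neq0 : n%:R != 0 :> R by case: n m => [[]|n m] //; rewrite pnatr_eq0.
have period (t : R) (q : nat) : cis (t + q%:R * (2 * pi)) = cis t.
  elim: q => [|q IHq]; first by rewrite mul0r addr0.
  rewrite -natr1 mulrDl mul1r addrA -[RHS]IHq [2 * pi]mulr_natl.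
  by rewrite /cis cosD2pi sinD2pi.
have cis_modn i : cis (i%:R * alpha R m) = cis ((i %% n)%:R * alpha R m).
  rewrite {1}(divn_eq i n) addnC natrD mulrDl.
  rewrite (_ : (i %/ n * n)%:R * alpha R m = (i %/ n * m)%:R * (2 * pi)).
    by rewrite period.
  by rewrite !natrM /alpha; field.
by move=> kl; rewrite cis_modn kl -cis_modn.
Qed.

Lemma M2_fourier (R : realType) (n : nat) (m : 'I_n) :
  toCmx (M2 R n) *m fourier R m = (2 * ymode R m)%:C *: fourier R m.
Proof.
apply/matrixP => j k; rewrite mulmx_M2E !mxE -!/(cis _) /=.
have n_gt0 : (0 < n)%N by case: j => j; exact: leq_ltn_trans.
(* Row [j] carries the phase index [j.+1]; its neighbours, computed modulo [n], therefore have phase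
   indices congruent to [j.+2] and [j]. *)
rewrite (@cis_alpha_mod _ _ (j.+1 %% n).+1 j.+2); last first.
  by rewrite -addn1 modnDml addn1.
rewrite (@cis_alpha_mod _ _ ((j + n).-1 %% n).+1 j); last first.
  by rewrite -addn1 modnDml addn1 prednK ?modnDr // addn_gt0 n_gt0 orbT.
set c := (_^-1)%:C; set a := alpha R m; set z := cis _.
have -> : cis (j%:R * a) = cis (j.+1%:R * a - a).
  by rewrite -natr1 mulrDl mul1r addrK.
have -> : cis (j.+2%:R * a) = cis (j.+1%:R * a + a).
  by rewrite -[j.+2%:R]natr1 mulrDl mul1r.
have := cisDJ (j.+1%:R * a) a; rewrite -/z /ymode -/a => e.
rewrite -addrA -opprD -mulrDr e rmorphM rmorphB rmorph1 rmorph_nat; ring.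
Qed.

(** For a single column only the norm matters: each of the $n$ entries has squared modulus $1/n$. *)
Lemma fourier_orthonormal (R : realType) (n : nat) (m : 'I_n) :
  orthonormal_cols (fourier R m).
Proof.
have n_gt0 : 0 < n%:R :> R by case: n m => [[]|n m] //; rewrite ltr0n.
apply/matrixP => i k; rewrite !ord1 !mxE eqxx mulr1n.
under eq_bigr => j _.
  rewrite !mxE -/(cis _) rmorphM /= mulrACA.
  rewrite [Num.conj _]conjc_real [Num.conj _ * _]cis_sqr_norm mulr1.
  rewrite -rmorphM -invfM -expr2 sqr_sqrtr ?ltW //.
  over.
rewrite sumr_const card_ord -rmorphMn /= -mulr_natr mulVf ?rmorph1 //.
by rewrite gt_eqF.
Qed.

(** * Real data viewed as complex matrices *)

Lemma norm2_orthonormal (R : realType) (n : nat) (v : 'cV[R]_n) :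
  norm2 v = 1 -> v^T *m v = 1%:M.
Proof.
move=> v1; apply/matrixP => i j; rewrite !ord1 !mxE eqxx mulr1n.
rewrite -[RHS](expr1n R 2) -v1 sqr_sqrtr; last first.
  by apply: sumr_ge0 => k _; rewrite sqr_ge0.
by apply: eq_bigr => k _; rewrite mxE expr2.
Qed.

Lemma toCmx_orthonormal (R : realType) (n r : nat) (V : 'M[R]_(n, r)) :
  V^T *m V = 1%:M -> orthonormal_cols (toCmx V).
Proof.
move=> VV; rewrite /orthonormal_cols.
rewrite (_ : map_mx _ _ = toCmx V^T); last first.
  by apply/matrixP => i j; rewrite !mxE; exact: conjc_real.
by rewrite -map_mxM VV map_mx1.
Qed.

Lemma orthonormal_col_neq0 (R : realType) (n : nat) (x : 'cV[R[i]]_n) :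
  orthonormal_cols x -> x != 0.
Proof.
move=> xx; apply/eqP => x0; move: xx; rewrite x0 /orthonormal_cols mulmx0.
by move=> /matrixP/(_ 0 0)/eqP; rewrite !mxE eqxx mulr1n eq_sym oner_eq0.
Qed.

Lemma toCmx_eigenvector (R : realType) (n : nat) (A : 'M[R]_n) (a : R)
    (v : 'cV[R]_n) :
  A *m v = a *: v -> toCmx A *m toCmx v = a%:C *: toCmx v.
Proof. by move=> Av; rewrite -map_mxM Av map_mxZ. Qed.

(** The left-hand side is the projected matrix $\widetilde A$ of a rank-one step, which thus becomes
    the scalar eigenvalue in the K- and S-steps. *)
Lemma toCmx_rayleigh (R : realType) (n : nat) (A : 'M[R]_n) (a : R)
    (v : 'cV[R]_n) :
  A *m v = a *: v -> v^T *m v = 1%:M -> toCmx (v^T *m A *m v) = a%:C%:M.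
Proof.
by move=> Av vv; rewrite -mulmxA Av -scalemxAr vv scalemx1 map_scalar_mx.
Qed.

(** * The amplification factor *)

Lemma gDtP0 (R : realType) (p : R) : 0 <= p -> gDtP 0 p = (1 + p)^-1.
Proof.
move=> p_ge0; have p1_neq0 : 1 + p != 0 by rewrite gt_eqF // ltr_pwDl.
by rewrite /gDtP; field.
Qed.

(* At the pole the numerator is [theta^-1], so nothing cancels. *)
Lemma gDtP_pole (R : realType) (theta : R) : 0 < theta -> theta <= 1 ->
  `|gDtP theta p| @[p --> (theta^-1)^'-] --> +oo.
Proof.
move=> th_gt0 th_le1; apply/cvgryPge => B.
have ti_gt0 : 0 < theta^-1 by rewrite invr_gt0.
(* For [0 < p < theta^-1], [B] times the denominator is at most [C * (1 - theta * p)]. This is below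
   1, hence below the numerator, once [p] is within [(theta * C)^-1] of the pole. The summand 1 next
   to the norm of [B] keeps [C] positive. *)
pose C := (1 + theta^-1) ^+ 2 * (1 + `|B|).
have C_gt0 : 0 < C.
  by rewrite mulr_gt0 ?exprn_gt0 // ?addr_gt0 // ltr_pwDl.
near=> p.
have p_gt0 : 0 < p by near: p; exact: nbhs_left_gt.
have p_lt : p < theta^-1 by near: p; exact: nbhs_left_lt.
have p_gt : theta^-1 - (theta * C)^-1 < p.
  by near: p; apply: nbhs_left_gt; rewrite ltrBlDr ltrDl invr_gt0 mulr_gt0.
have d_gt0 : 0 < 1 - theta * p by rewrite subr_gt0 -ltr_pdivlMl // mulr1.
have d_lt : 1 - theta * p < C^-1.
  move: p_gt; rewrite -(ltr_pM2l th_gt0) mulrBr divff ?gt_eqF //.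
  rewrite invfM mulVKf ?gt_eqF //.
  by rewrite ltrBlDr => ?; rewrite ltrBlDl.
have D_gt0 : 0 < (1 + p) ^+ 2 * (1 - theta * p).
  by rewrite mulr_gt0 // exprn_gt0 // addr_gt0.
have N_ge1 : 1 <= 1 + (1 - theta) * p.
  by rewrite lerDl mulr_ge0 ?subr_ge0 // ltW.
rewrite /gDtP ger0_norm; last by rewrite divr_ge0 // ltW // (lt_le_trans ltr01).
rewrite ler_pdivlMr //; apply: le_trans N_ge1.
apply: (@le_trans _ _ (C * (1 - theta * p))); last first.
  by rewrite -ler_pdivlMl // mulr1 ltW.
rewrite mulrA ler_pM2r // /C mulrC.
apply: (@le_trans _ _ ((1 + p) ^+ 2 * (1 + `|B|))).
  by rewrite ler_pM2l ?exprn_gt0 ?addr_gt0 // (le_trans (ler_norm B)) // lerDr.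
rewrite ler_pM2r; last by rewrite ltr_pwDl.
by rewrite lerXn2r ?nnegrE ?addr_ge0 ?lerD2l // ltW.
Unshelve. all: by end_near.
Qed.

(** * One step from a rank-one state *)

(** With [a] and [b] the scalars [S1] and [S2], the new factors are $X' = x/(a(1+\psi))$ and $L' =
    b\,v^T/(1+\psi)$. Their product depends only on $b/a$, which the S-step determines. *)
Lemma dtp_step_assemble (R : realType) (nx nv : nat) (A : 'M[R]_nv)
    (dt dx theta lambda y : R) (x : 'cV[R[i]]_nx) (v : 'cV[R]_nv)
    (s' : factors R nx nv 1) :
  psd A -> 0 < dt -> 0 < dx -> A *m v = lambda *: v -> 0 <= lambda ->
  toCmx (M2 R nx) *m x = (2 * y)%:C *: x -> 0 <= y ->
  orthonormal_cols x -> v^T *m v = 1%:M ->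
  dtp_step A theta dt dx (Factors x 1%:M v) s' ->
  assemble s' = (gDtP theta (2 * (lambda * (dt / dx ^+ 2)) * y))%:C
                *: (x *m (toCmx v)^T).
Proof.
move=> psdA dt_gt0 dx_gt0 Av lam_ge0 Mx y_ge0 xx vv [_ _].
case: s' => X' S' V' [K' [S1 [S2 [L' /=]]]].
set tau := dt / dx ^+ 2.
have tau_ge0 : 0 <= tau by rewrite divr_ge0 ?exprn_ge0 ?ltW.
clearbody tau; set psi := 2 * (lambda * tau) * y.
have y2_ge0 : 0 <= 2 * y by rewrite mulr_ge0.
have psi_ge0 : 0 <= psi by rewrite mulr_ge0 // mulr_ge0 // mulr_ge0.
(* The K-step meets [psi] as weight [tau * lambda] times the [M2] eigenvalue [2 * y]; the L-step
   meets it as weight [tau * (2 * y)] times the [A] eigenvalue [lambda]. *)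
have psiE : psi = tau * lambda * (2 * y) by rewrite /psi; ring.
clearbody psi.
have psi1_neq0 : (1 + psi)%:C != 0 by rewrite fmorph_eq0 gt_eqF // ltr_pwDl.
rewrite (toCmx_rayleigh Av vv) mulmx1 !mul_mx_scalar !scalerA -!rmorphM.
move=> [eqK [X'X' _ K'E] eqS eqL [_ _ L'E]].
rewrite [S1]mx11_scalar [S2]mx11_scalar in eqS K'E eqL.
move: (S1 0 0) (S2 0 0) K'E eqS eqL => a b.
rewrite mul_mx_scalar => K'E eqS eqL.
have Kx : K' = (1 + psi)%:C^-1 *: x.
  have := resolvent_eigenvector K' 1 (psd_M2 R nx)
    (mulr_ge0 tau_ge0 lam_ge0) y2_ge0 Mx.
  by rewrite -psiE scale1r div1r => -[/(_ eqK)].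
(* Nonvanishing of [a] makes [X'] a multiple of [K'], hence of [x], so [X'] inherits the eigenvalue
   whatever phase the QR factorization picked. *)
have a_neq0 : a != 0.
  apply/eqP => a0; move/esym/eqP: Kx; rewrite K'E a0 scale0r.
  rewrite scaler_eq0 invr_eq0 (negbTE psi1_neq0).
  by rewrite (negbTE (orthonormal_col_neq0 xx)).
have MX' : toCmx (M2 R nx) *m X' = (2 * y)%:C *: X'.
  apply: (scalerI a_neq0); rewrite scalemxAr -K'E Kx -scalemxAr Mx.
  by rewrite scalerA mulrC -scalerA -Kx K'E scalerA mulrC -scalerA.
have MXE : (map_mx Num.conj X'^T) *m toCmx (M2 R nx) *m X' = (2 * y)%:C%:M.
  by rewrite -mulmxA MX' -scalemxAr X'X' scalemx1.
have eqb : b * (1 - theta * psi)%:C = a * (1 + (1 - theta) * psi)%:C.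
  move: eqS; rewrite MXE mul_scalar_mx => /matrixP/(_ 0 0).
  rewrite !mxE eqxx !mulr1n psiE !(rmorphD, rmorphN, rmorphM, rmorph1) /=.
  move=> /eqP; rewrite -subr_eq0 => /eqP e.
  by apply: subr0_eq; rewrite -[RHS]e; ring.
(* If [theta * psi] were 1, [eqb] and [a != 0] would force [1 + (1 - theta) * psi = 0], hence
   [psi = 0], a contradiction. The mere existence of a step thus excludes the pole. *)
have psith : (1 - theta * psi)%:C != 0.
  apply/negP => /eqP e0; move/eqP: eqb.
  rewrite e0 mulr0 eq_sym mulf_eq0 (negbTE a_neq0) fmorph_eq0 /= => /eqP n0.
  move: e0 => [e0]; have psi0 : psi = 0 by lra.
  by move: e0; rewrite psi0; lra.
(* The L-step has [A] on the right; transposing it and using the symmetry of [A] gives a resolvent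
   equation for a column. *)
have L'v : L'^T = (b / (1 + psi)%:C) *: toCmx v.
  have [] := resolvent_eigenvector L'^T b psdA
    (mulr_ge0 tau_ge0 y2_ge0) lam_ge0 (toCmx_eigenvector Av).
  rewrite mulrAC -psiE => + _; apply.
  rewrite {1}eqL MXE !mul_scalar_mx linearB /= !linearZ /= trmxK.
  rewrite trmx_mul map_trmx (psdA.1).
  by rewrite linearZ /= -scalemxAr -scalerN scalerA [(tau * _)%:C]rmorphM.
have X'E : X' = (a * (1 + psi)%:C)^-1 *: x.
  by rewrite invfM -scalerA -Kx K'E scalerA mulVf // scale1r.
(* The second QR factors enter only through their product [L'^T], so their choice is immaterial. *)
rewrite /assemble /= -mulmxA -[S']trmxK -trmx_mul -L'E L'v X'E.
rewrite linearZ /= -scalemxAl -scalemxAr scalerA; congr (_ *: _).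
rewrite /gDtP expr2 fmorph_div /= rmorphM /= [((1 + psi) * _)%:C]rmorphM /=.
have -> : b = a * (1 + (1 - theta) * psi)%:C / (1 - theta * psi)%:C.
  by rewrite -eqb mulfK.
move: psi1_neq0 psith.
move: (1 + psi)%:C (1 - theta * psi)%:C => p q p_neq0 q_neq0.
by field; rewrite q_neq0 p_neq0 a_neq0.
Qed.

Lemma is_trig_mx11 (R : pzSemiRingType) (B : 'M[R]_1) : is_trig_mx B.
Proof. by apply/is_trig_mxP => i j; rewrite !ord1 ltnn. Qed.

(** The last hypothesis makes the scalar S-step solvable; the K- and L-steps are solved on the
    eigenvectors by [resolvent_eigenvector]. *)
Lemma dtp_step_exists (R : realType) (nx nv : nat) (A : 'M[R]_nv)
    (dt dx theta lambda y : R) (x : 'cV[R[i]]_nx) (v : 'cV[R]_nv) :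
  psd A -> 0 < dt -> 0 < dx -> A *m v = lambda *: v -> 0 <= lambda ->
  toCmx (M2 R nx) *m x = (2 * y)%:C *: x -> 0 <= y ->
  orthonormal_cols x -> v^T *m v = 1%:M ->
  theta * (2 * (lambda * (dt / dx ^+ 2)) * y) != 1 ->
  exists s', dtp_step A theta dt dx (Factors x 1%:M v) s'.
Proof.
move=> psdA dt_gt0 dx_gt0 Av lam_ge0 Mx y_ge0 xx vv.
have tau_ge0 : 0 <= dt / dx ^+ 2 by rewrite divr_ge0 ?exprn_ge0 ?ltW.
rewrite /dtp_step /=; move: (dt / dx ^+ 2) tau_ge0 => tau tau_ge0.
set psi := 2 * (lambda * tau) * y => psi_neq.
have y2_ge0 : 0 <= 2 * y by rewrite mulr_ge0.
have psiE : psi = tau * lambda * (2 * y) by rewrite /psi; ring.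
clearbody psi.
have psith : (1 - theta * psi)%:C != 0.
  by rewrite fmorph_eq0 subr_eq0 eq_sym.
have MXE : (map_mx Num.conj x^T) *m toCmx (M2 R nx) *m x = (2 * y)%:C%:M.
  by rewrite -mulmxA Mx -scalemxAr xx scalemx1.
(* The witness keeps [x] and [v] as bases, taking trivial QR phases. The scalars [a], [b] and [c]
   are the coefficients after the K-, S- and L-steps. *)
pose a : R[i] := (1 + psi)%:C^-1.
pose b := a * (1 + (1 - theta) * psi)%:C / (1 - theta * psi)%:C.
have eqb : b * (1 - theta * psi)%:C = a * (1 + (1 - theta) * psi)%:C.
  by rewrite divfK.
clearbody b; pose c := b / (1 + psi)%:C.
exists (Factors x c%:M v); split=> //=; first exact: toCmx_orthonormal.
exists (a *: x), a%:M, b%:M, (c *: (toCmx v)^T).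
rewrite (toCmx_rayleigh Av vv) MXE !mul_scalar_mx mulmx1 !mul_mx_scalar.
rewrite !scalerA -?rmorphM.
split.
- have [_] := resolvent_eigenvector (a *: x) 1 (psd_M2 R nx)
    (mulr_ge0 tau_ge0 lam_ge0) y2_ge0 Mx.
  rewrite -psiE div1r scale1r -scalemxAr scalerA => /(_ erefl); apply.
- by split=> //; rewrite ?is_trig_mx11 // mul_mx_scalar.
- apply/matrixP => i j; rewrite !ord1 !mxE eqxx !mulr1n -psiE.
  move/eqP: eqb; rewrite -subr_eq0 => /eqP e.
  by apply: subr0_eq; rewrite -[RHS]e; ring.
- have [_] := resolvent_eigenvector (c *: toCmx v) b psdA
    (mulr_ge0 tau_ge0 y2_ge0) lam_ge0 (toCmx_eigenvector Av).
  rewrite (mulrAC tau) -psiE => /(_ erefl)/(congr1 trmx).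
  rewrite linearB /= !linearZ /= trmx_mul (map_trmx _ A) psdA.1 => ->.
  by rewrite -scalemxAl -scalerN !scalerA [(tau * _)%:C]rmorphM -mulrA.
- split; [exact: toCmx_orthonormal | exact: is_trig_mx11 |].
  by rewrite linearZ /= trmxK tr_scalar_mx mul_mx_scalar.
Qed.

Theorem proposition4p2 (R : realType) (nx nv : nat) (A : 'M[R]_nv)
    (dt dx theta lambda : R) (m : 'I_nx) (v : 'cV[R]_nv)
    (U : 'M[R[i]]_(nx, nv)) :
  psd A -> 0 < dt -> 0 < dx -> 0 <= theta <= 1 ->
  A *m v = lambda *: v -> 0 <= lambda -> norm2 v = 1 ->
  U = fourier R m *m (toCmx v)^T ->
  let mu := lambda * (dt / dx ^+ 2) in
  let psi := 2 * mu * ymode R m in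
  let s := Factors (fourier R m) 1%:M v in
  [/\ theta * psi != 1 ->
        exists s' : factors R nx nv 1, dtp_step A theta dt dx s s',
      forall s' : factors R nx nv 1, dtp_step A theta dt dx s s' ->
        assemble s' = (gDtP theta psi)%:C *: U,
      theta = 0 -> forall p : R, 0 <= p -> gDtP theta p = (1 + p)^-1 &
      0 < theta -> theta != 2^-1 ->
        `|gDtP theta p| @[p --> (theta^-1)^'-] --> +oo].
Proof.
move=> psdA dt_gt0 dx_gt0 /andP[_ th_le1] Av lam_ge0 v1 -> mu psi s.
have vv := norm2_orthonormal v1.
have xx := fourier_orthonormal R m.
have Mx := M2_fourier R m.
have y_ge0 : 0 <= ymode R m by rewrite subr_ge0 cos_le1.
split.
- exact: dtp_step_exists.
- move=> s'; exact: dtp_step_assemble.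
- by move=> -> p; exact: gDtP0.
- by move=> th_gt0 _; exact: gDtP_pole.
Qed.
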